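(* Let $q$ be a prime power of the form $q=12c^2+4c+3$ for some integer $c$, and let $n=q^2$. Then there exists a Hadamard matrix of order $4(2n+1)$.
   Context: A Hadamard matrix of order $v$ is a $v\times v$ matrix $H$ with entries $\pm1$ such that $HH^{\top}=vI$. *)

(* Defs.v *)
From HB Require Import structures.
From mathcomp Require Import all_boot all_order all_algebra.
Set Implicit Arguments. Unset Strict Implicit. Unset Printing Implicit Defensive.
Import GRing.Theory Num.Theory.
Local Open Scope ring_scope.

Definition is_hadamard (v : nat) (H : 'M[int]_v) : Prop :=
  (forall i j, H i j = 1 \/ H i j = -1) /\ H *m H^T = (v%:R)%:M.

Definition hadamard_exists (v : nat) : Prop :=
  exists H : 'M[int]_v, is_hadamard H.

Definition prime_power (q : nat) : Prop :=
  exists p k : nat, prime p /\ (0 < k)%N /\ q = (p ^ k)%N.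

(* Main.v *)
Require Import Defs.
From HB Require Import structures.
From mathcomp Require Import all_boot all_order all_algebra all_field.
From mathcomp Require Import ring zify.
Import GRing.Theory Num.Theory.
Local Open Scope ring_scope.
Set Implicit Arguments.
Unset Strict Implicit.
Unset Printing Implicit Defensive.

(** As 4c (3c + 1) is divisible by 8, q = 3 mod 8.

    By the Wallis-Whiteman array it suffices to find four +-1 functions on
    Z_2 x K, K the field of order q^2, one of sum 2 and three of sum 0, whose
    autocorrelations add up to 4 (2 q^2 + 1) [x = 0] - 4.  Write them as s +- t
    on the two copies of K: then s and t are {0, 1, -1}-valued with
    complementary supports, and the autocorrelations of the four s (of the four
    t) must add up to (2 q^2 + 1) [x = 0] - 2 (to (2 q^2 + 1) [x = 0]).

    Let E be the subfield of order q and g a primitive element of K.  The q + 1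
    lines E g^l fall into four classes l mod 4.  For each class j let D_j be
    the function equal to +-1 on the class that changes sign with the quadratic
    character eta of E along each line (so D_j = 1 on g^l for l = j mod 8 and
    -1 for l = j + 4 mod 8), and A_j the function equal on each line of the
    class to a constant sign, these signs summing to 1 over the class.  All s
    and t are combinations of the origin and of U_j = (A_j + D_j) / 2 and
    V_j = (D_j - A_j) / 2.

    An identity between functions on K can be checked after pushing them
    forward to E along every nonzero E-linear form.  The form with kernel E v
    sends A_j to (q A_j(v) - 1) [u = 0] + (1 - A_j(v)) and D_j to a multiple of
    eta.  By the Frobenius automorphism and q = 3 mod 8, the multiples of eta
    for v running through the classes mod 8 are 0, y, x, -y, 0, -y, -x, y, and a
    second moment computation gives x^2 + 2 y^2 = q.  The autocorrelations then
    reduce to polynomial identities in x and y. *)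

(** * Hadamard matrices indexed by finite types, and correlations *)

Lemma hadamard_exists_card (T : finType) (H : T -> T -> int) :
  (forall x y, H x y = 1 \/ H x y = -1) ->
  (forall x y, \sum_z H x z * H y z = (#|T| * (x == y))%:R) ->
  hadamard_exists #|T|.
Proof.
move=> Hpm Horth; exists (\matrix_(i, j) H (enum_val i) (enum_val j)).
split=> [i j|]; first by rewrite mxE.
apply/matrixP=> i j; rewrite !mxE.
under eq_bigr => k _ do rewrite !mxE.
rewrite -(big_enum_val (A := T) (fun z => H (enum_val i) z * H (enum_val j) z)) /=.
rewrite Horth (inj_eq enum_val_inj); case: eqP => _; rewrite ?muln1 ?muln0 //.
Qed.

Section Correlation.
Variable G : finZmodType.
Implicit Types (f k : G -> int) (x : G).

Definition xcorr f k x : int := \sum_u f u * k (u + x).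
Definition conv f k x : int := \sum_u f u * k (x - u).

Lemma xcorrN f k x : xcorr f k (- x) = xcorr k f x.
Proof.
rewrite /xcorr (reindex_inj (addIr x)) /=.
by apply: eq_bigr => u _; rewrite addrK mulrC.
Qed.

Lemma convC f k x : conv f k x = conv k f x.
Proof.
rewrite /conv (reindex_inj (inv_inj (subKr x))) /=.
by apply: eq_bigr => u _; rewrite subKr mulrC.
Qed.

Lemma sum_xcorr f k : \sum_x xcorr f k x = (\sum_u f u) * (\sum_u k u).
Proof.
rewrite exchange_big big_distrl /=; apply: eq_bigr => u _.
by rewrite -big_distrr /= [in RHS](reindex_inj (addrI u)).
Qed.

End Correlation.

(** * The Wallis-Whiteman array *)

(* Signs, block indices and reflections of the Goethals-Seidel array
     A      B R     C R     D R
    -B R    A       D^T R  -C^T R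
    -C R   -D^T R   A       B^T R
    -D R    C^T R  -B^T R   A
   in which A(g,h) = a(h - g), (B R)(g,h) = b(g + h), (B^T R)(g,h) = b(-(g + h)). *)
Definition gs_sign (i j : nat) : int :=
  match i, j with
  | 1, 0 | 2, 0 | 3, 0 | 1, 3 | 2, 1 | 3, 2 => (-1)%R
  | _, _ => 1%R
  end%N.

Definition gs_index (i j : nat) : nat :=
  match i, j with
  | 0, 1 | 1, 0 | 2, 3 | 3, 2 => 1
  | 0, 2 | 2, 0 | 1, 3 | 3, 1 => 2
  | 0, 3 | 3, 0 | 1, 2 | 2, 1 => 3
  | _, _ => 0
  end%N.

Definition gs_arg (G : zmodType) (i j : nat) (g h : G) : G :=
  if i == j then h - g else if (i == 0%N) || (j == 0%N) then g + h else - (g + h).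

Definition gs_entry (G : zmodType) (f : nat -> G -> int) (i j : nat) (g h : G) : int :=
  gs_sign i j * f (gs_index i j) (gs_arg i j g h).

(* A 4 x 4 Hadamard matrix h, bordering the array on the left; above the array
   stands c, with  h (J - 2 I) = - 2 c^T. *)
Definition left_border (i j : nat) : int :=
  if (i == 0%N) || (j == 0%N) || (i == j) then 1 else -1.
Definition top_border (i j : nat) : int :=
  if j == 0%N then -1 else left_border j i.
Definition corner (i j : nat) : int := if i == j then -1 else 1.

Section WallisWhiteman.
Variables (G : finZmodType) (f : nat -> G -> int).

Lemma gs_sum_entry (i j : 'I_4) (g : G) :
  \sum_h gs_entry f i j g h = gs_sign i j * \sum_h f (gs_index i j) h.
Proof.
rewrite -big_distrr /=; congr (_ * _); rewrite /gs_arg.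
symmetry; case: (i == j :> nat); first by rewrite (reindex_inj (addIr (- g))).
case: (_ || _); first by rewrite (reindex_inj (addrI g)).
by rewrite (reindex_inj oppr_inj) (reindex_inj (addrI g)).
Qed.

(** Each product of two blocks is a correlation or a convolution. Off the diagonal the four terms
    cancel in pairs, for the convolutions by commutativity. *)
Lemma gs_orth (i j : 'I_4) (g g' : G) :
  \sum_(k < 4) \sum_h gs_entry f i k g h * gs_entry f j k g' h =
  if i == j then \sum_(k < 4) xcorr (f k) (f k) (g' - g) else 0.
Proof.
have S11 (k l : G -> int) (x y : G) :
    \sum_h k (h - x) * l (h - y) = xcorr k l (x - y).
  rewrite (reindex_inj (addIr x)) /=; apply: eq_bigr => u _.
  by rewrite addrK addrA.
have S22 (k l : G -> int) (x y : G) :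
    \sum_h k (x + h) * l (y + h) = xcorr l k (x - y).
  rewrite -xcorrN opprB (reindex_inj (addrI (- x))) /=; apply: eq_bigr => u _.
  by rewrite addrA subrr add0r addrA addrC.
have S33 (k l : G -> int) (x y : G) :
    \sum_h k (- (x + h)) * l (- (y + h)) = xcorr k l (x - y).
  rewrite (reindex_inj (addrI (- x))) (reindex_inj oppr_inj) /=.
  apply: eq_bigr => u _; congr (k _ * l _).
    by rewrite addrA subrr add0r opprK.
  by rewrite !opprD !opprK addrA addrC [- y + x]addrC.
have S12 (k l : G -> int) (x y : G) :
    \sum_h k (h - x) * l (y + h) = xcorr k l (x + y).
  rewrite (reindex_inj (addIr x)) /=; apply: eq_bigr => u _.
  by rewrite addrK addrCA [y + x]addrC.
have S21 (k l : G -> int) (x y : G) :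
    \sum_h k (x + h) * l (h - y) = xcorr l k (x + y).
  by under eq_bigr do rewrite mulrC; rewrite S12 addrC.
have S13 (k l : G -> int) (x y : G) :
    \sum_h k (h - x) * l (- (y + h)) = conv k l (- (x + y)).
  rewrite (reindex_inj (addIr x)) /=; apply: eq_bigr => u _.
  by rewrite addrK addrCA [y + x]addrC [u + _]addrC opprD.
have S31 (k l : G -> int) (x y : G) :
    \sum_h k (- (x + h)) * l (h - y) = conv k l (- (x + y)).
  by under eq_bigr do rewrite mulrC; rewrite S13 addrC convC.
have S23 (k l : G -> int) (x y : G) :
    \sum_h k (x + h) * l (- (y + h)) = conv k l (x - y).
  rewrite (reindex_inj (addrI (- x))) /=; apply: eq_bigr => u _.
  congr (k _ * l _); first by rewrite addrA subrr add0r.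
  by rewrite !opprD opprK addrA [- y + x]addrC.
have S32 (k l : G -> int) (x y : G) :
    \sum_h k (- (x + h)) * l (y + h) = conv k l (y - x).
  by under eq_bigr do rewrite mulrC; rewrite S23 convC.
transitivity (\sum_(k < 4) gs_sign i k * gs_sign j k *
    \sum_h f (gs_index i k) (gs_arg i k g h) * f (gs_index j k) (gs_arg j k g' h)).
  apply: eq_bigr => k _; rewrite big_distrr /=.
  by apply: eq_bigr => h _; rewrite /gs_entry mulrACA.
rewrite !big_ord_recr !big_ord0 /= -[g' - g]opprB.
have E k x : xcorr k k (- x) = xcorr k k x by exact: xcorrN.
case: i => -[|[|[|[|]]]] // ?; case: j => -[|[|[|[|]]]] // ?;
  rewrite /= /gs_arg /= ?(S11, S22, S33, S12, S21, S13, S31, S23, S32) ?E;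
  rewrite ?E ?(convC (f 3)) ?(convC (f 2) (f 0)) ?(convC (f 2) (f 1))
    ?(convC (f 1) (f 0)); ring.
Qed.

Definition ww_entry (x y : 'I_4 + 'I_4 * G) : int :=
  match x, y with
  | inl i, inl j => corner i j
  | inl i, inr (j, _) => top_border i j
  | inr (i, _), inl j => left_border i j
  | inr (i, g), inr (j, h) => gs_entry f i j g h
  end.

Theorem wallis_whiteman :
  (forall i g, (i < 4)%N -> f i g = 1 \/ f i g = -1) ->
  (forall i, (i < 4)%N -> \sum_g f i g = if i == 0%N then 2 else 0) ->
  (forall x, \sum_(k < 4) xcorr (f k) (f k) x =
     4 * (#|G|%:R + 1) * (x == 0)%:R - 4) ->
  hadamard_exists (4 * (#|G| + 1)).
Proof.
move=> fpm fsum fcorr.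
have cardT : #|{: 'I_4 + 'I_4 * G}| = (4 * (#|G| + 1))%N.
  by rewrite card_sum card_prod !card_ord mulnDr muln1 addnC.
rewrite -cardT; apply: (@hadamard_exists_card _ ww_entry).
  move=> [i|[i g]] [j|[j h]] /=.
  - by rewrite /corner; case: ifP; [right|left].
  - rewrite /top_border /left_border; case: ifP; first by right.
    by case: ifP; [left|right].
  - by rewrite /left_border; case: ifP; [left|right].
  - rewrite /gs_entry.
    have [] := fpm (gs_index i j) (gs_arg i j g h).
    + by case: i => -[|[|[|[|]]]] // ?; case: j => -[|[|[|[|]]]].
    + move=> ->; case: i => -[|[|[|[|]]]] // ?; case: j => -[|[|[|[|]]]] // ?;
      rewrite /=; by [left|right].
    + move=> ->; case: i => -[|[|[|[|]]]] // ?; case: j => -[|[|[|[|]]]] // ?;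
      rewrite /=; by [left|right].
have split_sum (F : 'I_4 + 'I_4 * G -> int) :
    \sum_z F z = \sum_(k < 4) F (inl k) + \sum_(k < 4) \sum_h F (inr (k, h)).
  by rewrite big_sumType /= pair_big /=; congr (_ + _); apply: eq_bigr => -[].
(* Only the diagonal block, built from [f 0], has a nonzero row sum, namely 2; it offsets the
   product of [corner] with [left_border]. *)
have cross (i j : 'I_4) (g : G) :
    \sum_z ww_entry (inl i) z * ww_entry (inr (j, g)) z = 0.
  rewrite split_sum /=.
  under [X in _ + X]eq_bigr => k _ do rewrite -big_distrr /= gs_sum_entry.
  rewrite !big_ord_recr !big_ord0 /=.
  case: i => -[|[|[|[|]]]] // ?; case: j => -[|[|[|[|]]]] // ?;
    by rewrite /= !fsum.
move=> [i|[i g]] [j|[j g']]; rewrite ?cardT.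
- rewrite split_sum /=.
  under [X in _ + X]eq_bigr => k _ do rewrite sumr_const.
  rewrite !big_ord_recr !big_ord0 /=.
  case: i => -[|[|[|[|]]]] // ?; case: j => -[|[|[|[|]]]] // ?;
  rewrite /top_border /left_border /corner /=; ring.
- by rewrite cross muln0.
- under eq_bigr => z _ do rewrite mulrC.
  by rewrite cross muln0.
- rewrite split_sum /= gs_orth.
  have -> : \sum_(k < 4) left_border i k * left_border j k = 4 * (i == j)%:R.
    rewrite !big_ord_recr !big_ord0 /=.
    by case: i => -[|[|[|[|]]]] // ?; case: j => -[|[|[|[|]]]] // ?.
  have -> : (inr (i, g) == inr (j, g') :> 'I_4 + 'I_4 * G) = (i == j) && (g == g') by [].
  case: (i == j) => /=; last by rewrite muln0.
  rewrite fcorr subr_eq0 [g' == g]eq_sym; case: (g == g') => /=; ring.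
Qed.
End WallisWhiteman.

(** * Doubling: pairs of functions with complementary supports *)

HB.instance Definition _ (U V : finZmodType) := GRing.Zmodule.on (U * V)%type.

Section Doubling.
Variables (K : finZmodType) (s t : nat -> K -> int).

Definition lift2 (i : nat) (x : 'Z_2 * K) : int :=
  s i x.2 + (if x.1 == 0 then t i x.2 else - t i x.2).

Lemma sum_Z2_prod (F : 'Z_2 * K -> int) :
  \sum_x F x = \sum_z F (0, z) + \sum_z F (1, z).
Proof.
have -> : \sum_x F x = \sum_(e : 'Z_2) \sum_z F (e, z).
  by rewrite pair_big /=; apply: eq_bigr => -[].
by rewrite !big_ord_recr big_ord0 /= add0r; congr (_ + _); apply: eq_bigr => z _;
  congr (F (_, z)); apply: val_inj.
Qed.

(** Translation by 1 in ['Z_2] exchanges s + t and s - t. For either value of e the products of s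
    with t cancel. *)
Lemma xcorr_lift2 i e x :
  xcorr (lift2 i) (lift2 i) (e, x) =
  2 * xcorr (s i) (s i) x + 2 * (if e == 0 then 1 else -1) * xcorr (t i) (t i) x.
Proof.
rewrite /xcorr sum_Z2_prod -!mulrA !big_distrr /= -!big_split /=.
apply: eq_bigr => z _; rewrite /lift2 /=.
by case: e => -[|[|]] //= ?; rewrite /=; ring.
Qed.

Theorem hadamard_of_disjoint_pairs :
  (forall i z, (i < 4)%N -> `|s i z| + `|t i z| = 1) ->
  (forall i, (i < 4)%N -> \sum_z s i z = (i == 0%N)%:R) ->
  (forall x, \sum_(k < 4) xcorr (s k) (s k) x =
     (2 * #|K| + 1)%:R * (x == 0)%:R - 2) ->
  (forall x, \sum_(k < 4) xcorr (t k) (t k) x = (2 * #|K| + 1)%:R * (x == 0)%:R) ->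
  hadamard_exists (4 * (2 * #|K| + 1)).
Proof.
move=> st1 sums corrs corrt.
have cardG : #|{: 'Z_2 * K}| = (2 * #|K|)%N by rewrite card_prod card_ord.
rewrite -cardG; apply: (@wallis_whiteman _ lift2).
- move=> i [e z] /(st1 _ z); rewrite /lift2 /=; case: ifP => _; lia.
- move=> i i4; rewrite sum_Z2_prod /lift2 /= !big_split /= sumrN sums //.
  by case: (i == 0%N) => /=; ring.
move=> [e x]; under eq_bigr => k _ do rewrite xcorr_lift2.
rewrite big_split /= -!big_distrr /= corrs corrt cardG.
have -> : ((e, x) == 0 :> 'Z_2 * K) = (e == 0) && (x == 0) by [].
by case: (e == 0); case: (x == 0) => /=; ring.
Qed.

End Doubling.

(** * Cyclotomic functions on the field of order q^2 *)

Lemma sum_ord_mul (m n : nat) (f : nat -> int) :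
  \sum_(i < m * n) f i = \sum_(a < m) \sum_(r < n) f (a * n + r)%N.
Proof.
elim: m => [|m IH]; first by rewrite !big_ord0.
rewrite big_ord_recr /= -IH -!(big_mkord xpredT f) mulSnr.
rewrite (big_cat_nat (n := m * n)) ?leq_addr //=; congr (_ + _).
by rewrite -{1}[(m * n)%N]add0n big_addn addKn big_mkord; apply: eq_bigr => i _; rewrite addnC.
Qed.

Lemma finField_primitive_root (F : finFieldType) :
  exists g : F, (#|F|.-1).-primitive_root g.
Proof.
have F1 : (0 < #|F|.-1)%N by rewrite -ltnS prednK ?finNzRing_gt1 // ltnW ?finNzRing_gt1.
pose rs := [seq x <- enum F | x != 0].
have rs_unity : all #|F|.-1.-unity_root rs.
  apply/allP=> x; rewrite mem_filter => /andP[x0 _].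
  rewrite unity_rootE -(inj_eq (mulIf x0)) mul1r -exprSr prednK ?expf_card //.
  by rewrite ltnW ?finNzRing_gt1.
have rs_size : (#|F|.-1 <= size rs)%N.
  by rewrite -(cardC1 (0 : F)) cardE {1}/enum_mem size_filter size_filter enumT.
have rs_uniq : uniq rs by rewrite filter_uniq ?enum_uniq.
by have /hasP[g _ ?] := cyclic.has_prim_root F1 rs_unity rs_uniq rs_size; exists g.
Qed.

Section CyclotomicPairs.
Variables (F : finFieldType) (b : nat) (g : F).
Let q : nat := (8 * b + 3)%N.
Hypothesis cardF : #|F| = (q ^ 2)%N.
Hypothesis frobD : forall x y : F, (x + y) ^+ q = x ^+ q + y ^+ q.
Hypothesis prim : (#|F|.-1).-primitive_root g.

Let n : nat := ((q - 1) * (q + 1))%N.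

Lemma card_pred : #|F|.-1 = n.
Proof. by rewrite cardF /n /q; lia. Qed.

Lemma prim_n : n.-primitive_root g. Proof. by rewrite -card_pred. Qed.

Lemma n_gt0 : (0 < n)%N. Proof. by rewrite muln_gt0 /q !addn_gt0 /=; lia. Qed.

Lemma g_neq0 : g != 0.
Proof.
apply/eqP=> g0; have /eqP := prim_expr_order prim_n.
by rewrite g0 expr0n gtn_eqF ?n_gt0 // eq_sym oner_eq0.
Qed.

(** Discrete logarithm to base g, with the junk value n at 0. *)
Definition lg (z : F) : nat := index z [seq g ^+ i | i <- iota 0 n].

Lemma lgK z : z != 0 -> g ^+ lg z = z.
Proof.
move=> z0; have zn : z ^+ n = 1.
  apply: (mulIf z0); rewrite mul1r -exprSr -card_pred prednK ?expf_card //.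
  by rewrite ltnW ?finNzRing_gt1.
have [i Di] := prim_rootP prim_n zn.
have zin : z \in [seq g ^+ i | i <- iota 0 n].
  by apply/mapP; exists (i : nat); rewrite ?mem_iota /=.
have := nth_index 0 zin; rewrite (nth_map 0%N) ?nth_iota //.
all: by move: zin; rewrite -index_mem size_map ?size_iota.
Qed.

Lemma lg_exp d i : (d %| n)%N -> lg (g ^+ i) = i %[mod d].
Proof.
move=> dn; have := lgK (expf_neq0 i g_neq0).
move/eqP; rewrite (eq_prim_root_expr prim_n) => /eqP E.
by rewrite -(modn_dvdm _ dn) E modn_dvdm.
Qed.

Lemma dvd8n : (8 %| n)%N.
Proof. by apply/dvdnP; exists ((4 * b + 1) * (2 * b + 1))%N; rewrite /n /q; nia. Qed.
Lemma dvd4n : (4 %| n)%N. Proof. exact: dvdn_trans dvd8n. Qed.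
Lemma dvdq1n : (q + 1 %| n)%N. Proof. exact: dvdn_mull. Qed.

Lemma sum_nonzero (f : F -> int) :
  \sum_(z | z != 0) f z = \sum_(i < n) f (g ^+ i).
Proof.
rewrite (reindex_onto (fun i : 'I_n => g ^+ i) (fun z => Ordinal (ltn_pmod (lg z) n_gt0))) /=.
  apply: eq_bigl => i; rewrite expf_neq0 ?g_neq0 //=; apply/eqP/val_inj => /=.
  by rewrite lg_exp // modn_small.
by move=> z z0; rewrite (prim_expr_mod prim_n) lgK.
Qed.


(* Membership in the subfield E of order q. *)
Definition subf (x : F) : bool := x ^+ q == x.

Lemma subfM x y : subf x -> subf y -> subf (x * y).
Proof. by rewrite /subf exprMn => /eqP-> /eqP->. Qed.

Lemma subfV x : subf x -> subf x^-1.
Proof. by rewrite /subf exprVn => /eqP->. Qed.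

Lemma q_gt0 : (0 < q)%N. Proof. by rewrite /q addn_gt0 orbT. Qed.

Lemma subf0 : subf 0. Proof. by rewrite /subf expr0n gtn_eqF ?q_gt0. Qed.

Lemma subf1 : subf 1. Proof. by rewrite /subf expr1n. Qed.

Lemma frobN (x : F) : (- x) ^+ q = - (x ^+ q).
Proof.
apply/eqP; rewrite -subr_eq0 opprK -frobD addNr expr0n gtn_eqF ?q_gt0 //.
Qed.

Lemma frobB (x y : F) : (x - y) ^+ q = x ^+ q - y ^+ q.
Proof. by rewrite frobD frobN. Qed.

Lemma frobK (x : F) : (x ^+ q) ^+ q = x.
Proof. by rewrite -exprM mulnn -cardF expf_card. Qed.

Lemma subfN x : subf x -> subf (- x).
Proof. by rewrite /subf frobN => /eqP->. Qed.

Lemma subfD x y : subf x -> subf y -> subf (x + y).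
Proof. by rewrite /subf frobD => /eqP-> /eqP->. Qed.

Lemma subf_expP l : subf (g ^+ l) = (q + 1 %| l)%N.
Proof.
rewrite /subf -exprM (eq_prim_root_expr prim_n) eqn_mod_dvd; last first.
  by rewrite leq_pmulr ?q_gt0.
rewrite -[X in (_ - X)%N]muln1 -mulnBr mulnC /n dvdn_pmul2l //.
by rewrite /q; lia.
Qed.

Lemma subf_gP t : t != 0 -> subf t -> exists k, t = g ^+ ((q + 1) * k).
Proof.
move=> t0; rewrite -{1}(lgK t0) subf_expP => /dvdnP[k Dk]; exists k.
by rewrite mulnC -Dk lgK.
Qed.

Lemma g_half : g ^+ (n %/ 2) = -1.
Proof.
have n2 : n = (2 * (n %/ 2))%N by have := dvd8n; lia.
have /eqP : (g ^+ (n %/ 2)) ^+ 2 = 1.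
  by rewrite -exprM mulnC -n2 (prim_expr_order prim_n).
rewrite sqrf_eq1 => /orP[|/eqP //].
rewrite -(prim_order_dvd prim_n) => /dvdn_leq.
by have := n_gt0; lia.
Qed.

(** * The functions D_j, A_j, U_j and V_j *)

Definition dn (j l : nat) : int :=
  if (l %% 8 == j)%N then 1 else if (l %% 8 == j + 4)%N then -1 else 0.
(** The line E g^l is determined by l modulo q + 1 = 4 (2b + 1). The 2b + 1 lines of class j carry
    alternating signs, beginning and ending with 1. *)
Definition an (j l : nat) : int :=
  if (l %% 4 == j)%N then (-1) ^+ ((l %% (q + 1)) %/ 4) else 0.
Definition Dc j (z : F) : int := if z == 0 then 0 else dn j (lg z).
Definition Ac j (z : F) : int := if z == 0 then 0 else an j (lg z).
(** Division-free forms of (A_j + D_j) / 2 and (D_j - A_j) / 2: D_j restricted to where it agrees,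
    or disagrees, with A_j. *)
Definition Uc j z : int := if Ac j z == Dc j z then Dc j z else 0.
Definition Vc j z : int := if Ac j z == Dc j z then 0 else Dc j z.

Lemma Dc_exp j l : Dc j (g ^+ l) = dn j l.
Proof.
by rewrite /Dc (negbTE (expf_neq0 l g_neq0)) /dn (lg_exp l dvd8n).
Qed.

Lemma Ac_exp j l : Ac j (g ^+ l) = an j l.
Proof.
rewrite /Ac (negbTE (expf_neq0 l g_neq0)) /an (lg_exp l dvd4n).
by rewrite (lg_exp l dvdq1n).
Qed.

Lemma Dc0 j : Dc j 0 = 0. Proof. by rewrite /Dc eqxx. Qed.
Lemma Ac0 j : Ac j 0 = 0. Proof. by rewrite /Ac eqxx. Qed.

Lemma expgP z : z != 0 -> exists l, z = g ^+ l.
Proof. by move=> z0; exists (lg z); rewrite lgK. Qed.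

Lemma dn4 j l : (j < 4)%N -> dn j (l + 4) = - dn j l.
Proof. by move=> j4; rewrite /dn; do ![case: eqP]; lia. Qed.

Lemma dn4k j l k : (j < 4)%N -> dn j (4 * k + l) = (-1) ^+ k * dn j l.
Proof.
move=> j4; elim: k => [|k IH]; first by rewrite mul1r.
by rewrite mulnS [(4 + _)%N]addnC addnAC dn4 // IH exprS mulN1r mulNr.
Qed.

Lemma q1E : (q + 1 = 4 * (2 * b + 1))%N. Proof. by rewrite /q; lia. Qed.

(** The powers of g^(q+1) exhaust the nonzero part of E, and q + 1 is 4 times an odd number, so
    multiplication by g^(q+1) negates [Dc j]. On E, [Dc 0] is thus the quadratic character. *)
Lemma Dc_subf j t z : (j < 4)%N -> subf t -> Dc j (t * z) = Dc 0 t * Dc j z.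
Proof.
move=> j4 Et; have [->|z0] := eqVneq z 0; first by rewrite mulr0 Dc0 mulr0.
have [->|t0] := eqVneq t 0; first by rewrite mul0r !Dc0 mul0r.
have [l ->] := expgP z0; have [k ->] := subf_gP t0 Et.
rewrite -exprD !Dc_exp q1E -mulnA dn4k // -[X in dn 0 X]addn0 dn4k //.
by rewrite mulr1.
Qed.

Lemma Ac_subf j t z : t != 0 -> subf t -> Ac j (t * z) = Ac j z.
Proof.
move=> t0 Et; have [->|z0] := eqVneq z 0; first by rewrite mulr0.
have [l ->] := expgP z0; have [k ->] := subf_gP t0 Et.
rewrite -exprD !Ac_exp /an [((q + 1) * k)%N]mulnC modnMDl.
by rewrite {1}q1E mulnCA [(4 * _)%N]mulnC modnMDl.
Qed.

Lemma AcE j z : (j < 4)%N -> Ac j z = Uc j z - Vc j z.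
Proof.
move=> j4; rewrite /Uc /Vc; case: eqP => [->|]; first by rewrite subr0.
have [->|z0] := eqVneq z 0; first by rewrite Ac0 Dc0.
have [l ->] := expgP z0; rewrite Ac_exp Dc_exp /an /dn sub0r.
rewrite -signr_odd; case: (odd _); rewrite ?expr1 ?expr0; do ![case: eqP]; lia.
Qed.

Lemma DcE j z : Dc j z = Uc j z + Vc j z.
Proof. by rewrite /Uc /Vc; case: ifP; rewrite ?addr0 ?add0r. Qed.

Lemma q_m1_gt0 : (0 < q - 1)%N. Proof. by rewrite /q; lia. Qed.

Lemma sum_sign_odd m : \sum_(k < (2 * m + 1)%N) (-1) ^+ k = 1 :> int.
Proof.
elim: m => [|m IH]; first by rewrite big_ord1.
have -> : (2 * m.+1 + 1 = (2 * m + 1).+2)%N by lia.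
by rewrite !big_ord_recr /= IH exprS mulN1r addrK.
Qed.

Lemma sum_Ac j : (j < 4)%N -> \sum_z Ac j z = (q - 1)%:R.
Proof.
move=> j4; rewrite (bigD1 0) //= Ac0 add0r sum_nonzero.
under eq_bigr => i _ do rewrite Ac_exp.
rewrite sum_ord_mul.
have blockE (a : nat) : \sum_(r < (q + 1)%N) an j (a * (q + 1) + r) = 1.
  pose sgn4 r : int := if (r %% 4 == j)%N then (-1) ^+ (r %/ 4) else 0.
  transitivity (\sum_(r < (q + 1)%N) sgn4 r).
    apply: eq_bigr => r _; rewrite /an modnMDl (modn_small (ltn_ord r)).
    by rewrite {1}q1E mulnCA [(4 * _)%N]mulnC modnMDl.
  have -> : (q + 1 = (2 * b + 1) * 4)%N by rewrite q1E mulnC.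
  rewrite sum_ord_mul -[RHS](sum_sign_odd b); apply: eq_bigr => k _.
  rewrite !big_ord_recr big_ord0 /= /sgn4 !modnMDl !divnMDl // !addn0.
  by case: j j4 {sgn4} => [|[|[|[|]]]] //= _; rewrite ?addr0 ?add0r.
under eq_bigr => a _ do rewrite blockE.
by rewrite sumr_const card_ord.
Qed.

Lemma sum_subf (f : F -> int) :
  \sum_(u | subf u) f u = f 0 + \sum_(u : F | (u != 0) && subf u) f u.
Proof.
rewrite (bigD1 0) ?subf0 //=; congr (_ + _).
by apply: eq_bigl => u; rewrite andbC.
Qed.

Lemma subf_dilate t : t != 0 -> subf t -> forall z, subf (t * z) = subf z.
Proof.
move=> t0 Et z; apply/idP/idP; last exact: subfM.
by move=> /(subfM (subfV Et)); rewrite mulKf.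
Qed.

Lemma sum_subf_dilate (f : F -> int) t : t != 0 -> subf t ->
  \sum_(u : F | (u != 0) && subf u) f u = \sum_(u : F | (u != 0) && subf u) f (t * u).
Proof.
move=> t0 Et; rewrite (reindex_inj (mulfI t0)) /=; apply: eq_bigl => u.
by rewrite mulf_eq0 (negbTE t0) subf_dilate.
Qed.

Lemma card_subf_nonzero : \sum_(u : F | (u != 0) && subf u) (1 : int) = (q - 1)%:R.
Proof.
rewrite big_mkcondr /= sum_nonzero.
under eq_bigr => i _ do rewrite subf_expP.
rewrite (sum_ord_mul _ _ (fun i => if (q + 1 %| i)%N then 1 else 0)).
transitivity (\sum_(a < (q - 1)%N) (1 : int)); last by rewrite sumr_const card_ord.
apply: eq_bigr => a _.
rewrite addn1 big_ord_recl /= addn0 dvdn_mull // big1 ?addr0 // => r _.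
rewrite dvdn_addr ?dvdn_mull // gtnNdvd //=.
by rewrite /bump ltnS add1n ltn_ord.
Qed.


(** * Pushing forward to the subfield *)

Definition w : F := g ^+ ((q + 1) %/ 2).

Lemma w_neq0 : w != 0. Proof. exact: expf_neq0 g_neq0. Qed.

(** w^(q-1) = g^(n/2) = -1. *)
Lemma frob_w : w ^+ q = - w.
Proof.
have qE : q = (q - 1).+1 by rewrite /q; lia.
have q1_half : (q + 1 = 2 * (4 * b + 2))%N by rewrite /q; lia.
rewrite {1}qE exprSr /w -exprM.
have -> : ((q + 1) %/ 2 * (q - 1) = n %/ 2)%N.
  by rewrite /n q1_half mulnCA !mulKn // mulnC.
by rewrite g_half mulN1r.
Qed.

(* An E-linear form on F with kernel E; the factor w makes it E-valued, since w^q = - w. *)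
Definition tau (z : F) : F := w * (z - z ^+ q).

Lemma tauB x y : tau (x - y) = tau x - tau y.
Proof. by rewrite /tau frobB -mulrBr; congr (_ * _); ring. Qed.

Lemma tau_subf z : subf (tau z).
Proof. by rewrite /subf /tau exprMn frobB frobK frob_w mulNr -mulrN opprB. Qed.

Lemma tauZ t z : subf t -> tau (t * z) = t * tau z.
Proof. by move=> /eqP Et; rewrite /tau exprMn Et -mulrBr mulrCA. Qed.

Lemma tau_eq0 z : (tau z == 0) = subf z.
Proof. by rewrite /tau mulf_eq0 (negbTE w_neq0) /= subr_eq0 eq_sym. Qed.

Lemma tau_frob z : tau (z ^+ q) = - tau z.
Proof. by rewrite /tau frobK -mulrN opprB. Qed.

(** Pushforward along the E-linear form z -> tau (z / v), whose kernel is E v. *)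
Definition push (v : F) (f : F -> int) (u : F) : int :=
  \sum_(z | tau (z / v) == u) f z.

Lemma sum_push v f : \sum_(u | subf u) push v f u = \sum_z f z.
Proof. by rewrite [RHS](partition_big (fun z => tau (z / v)) subf) // => z _; exact: tau_subf. Qed.

Lemma push_dilate v f t u : t != 0 -> subf t ->
  push v f (t * u) = push v (fun z => f (t * z)) u.
Proof.
move=> t0 Et; rewrite /push (reindex_inj (mulfI t0)) /=; apply: eq_bigl => z.
by rewrite -mulrA tauZ // (inj_eq (mulfI t0)).
Qed.

Lemma eq_push v f f' u : (forall z, f z = f' z) -> push v f u = push v f' u.
Proof. by move=> E; apply: eq_bigr => z _. Qed.

Lemma push0 v f : v != 0 -> push v f 0 = \sum_(t | subf t) f (t * v).
Proof.
move=> v0; rewrite /push (reindex_inj (mulIf v0)) /=; apply: eq_bigl => z.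
by rewrite mulfK // tau_eq0.
Qed.

Lemma push_xcorr v f s : 
  push v (xcorr f f) s = \sum_(u | subf u) push v f u * push v f (u + s).
Proof.
rewrite /push /xcorr exchange_big /=.
rewrite (partition_big (fun z => tau (z / v)) subf) => [|z _]; last exact: tau_subf.
apply: eq_bigr => u _; rewrite big_distrl /=; apply: eq_bigr => z /eqP Dz.
rewrite -big_distrr /=; congr (_ * _).
rewrite (reindex_inj (addrI (- z))) /=; apply: eq_big => [d|d _]; last first.
  by rewrite addrA subrr add0r.
by rewrite addrC mulrBl tauB Dz subr_eq addrC.
Qed.

Lemma sum_Dc_subf : \sum_(t | subf t) Dc 0 t = 0.
Proof.
rewrite sum_subf Dc0 add0r; set S := LHS.
have [Eg Dg] : subf (g ^+ (q + 1)) /\ Dc 0 (g ^+ (q + 1)) = -1.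
  rewrite subf_expP dvdnn; split=> //.
  by rewrite Dc_exp q1E -[X in dn 0 X]addn0 dn4k // -signr_odd oddD oddM.
suff : S = - S by lia.
rewrite {1}/S (sum_subf_dilate _ (expf_neq0 (q + 1) g_neq0) Eg) -sumrN.
by apply: eq_bigr => t _; rewrite Dc_subf // Dg mulN1r.
Qed.

Lemma Dc_subf_sqr t : t != 0 -> subf t -> Dc 0 t ^+ 2 = 1.
Proof.
move=> t0 Et; have [k ->] := subf_gP t0 Et.
rewrite Dc_exp q1E -mulnA -[X in dn 0 X]addn0 dn4k //.
by rewrite mulr1 sqrr_sign.
Qed.

(** -1 = g^(n/2), and n / 2 is 4 times an odd number because q = 3 mod 8. *)
Lemma Dc_N1 : Dc 0 (-1) = -1.
Proof.
rewrite -g_half Dc_exp.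
have -> : (n %/ 2 = 4 * ((4 * b + 1) * (2 * b + 1)) + 0)%N.
  rewrite addn0 /n; have -> : (q - 1 = 2 * (4 * b + 1))%N by rewrite /q; lia.
  by rewrite q1E -mulnA mulKn // mulnCA.
have odd_n8 : odd ((4 * b + 1) * (2 * b + 1)) by rewrite oddM; lia.
by rewrite dn4k // -signr_odd odd_n8.
Qed.

Lemma Dc_N t : Dc 0 (- t) = - Dc 0 t.
Proof. by rewrite -mulN1r Dc_subf ?subfN ?subf1 // Dc_N1 mulN1r. Qed.

(** Dilation by a nonzero u in E multiplies [Dc j] by [Dc 0 u]; at u = 0 the sum of the character
    over E vanishes. *)
Lemma push_Dc v j u : v != 0 -> (j < 4)%N -> subf u ->
  push v (Dc j) u = Dc 0 u * push v (Dc j) 1.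
Proof.
move=> v0 j4 Eu; have [->|u0] := eqVneq u 0.
  rewrite push0 // Dc0 mul0r.
  under eq_bigr => t Et do rewrite Dc_subf //.
  by rewrite -big_distrl /= sum_Dc_subf mul0r.
rewrite -{1}[u]mulr1 push_dilate // /push big_distrr /=.
by apply: eq_bigr => z _; rewrite Dc_subf.
Qed.

(* An E^*-invariant function pushes forward to one, so it is determined there by
   its value at 0 and its total sum. *)
Lemma push_invariant v f (S : int) u : v != 0 ->
  (forall t z, t != 0 -> subf t -> f (t * z) = f z) -> f 0 = 0 ->
  \sum_z f z = (q - 1)%:R * S -> subf u ->
  push v f u = (q%:R * f v - S) * (u == 0)%:R + (S - f v).
Proof.
move=> v0 finv f0 fsum Eu.
have P0 : push v f 0 = (q - 1)%:R * f v.
  rewrite push0 // sum_subf mul0r f0 add0r -card_subf_nonzero big_distrl /=.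
  by apply: eq_bigr => t /andP[t0 Et]; rewrite finv // mul1r.
have qE : q%:R = (q - 1)%:R + 1 :> int by rewrite natr1; congr _%:R; rewrite /q; lia.
have [->|u0] := eqVneq u 0; first by rewrite P0 qE /=; ring.
rewrite /= mulr0 add0r; apply: (@mulfI _ ((q - 1)%:R : int)).
  by rewrite pnatr_eq0 -lt0n q_m1_gt0.
rewrite mulrBr -fsum -P0 -(sum_push v f) sum_subf addrC addKr.
rewrite -card_subf_nonzero big_distrl /=; apply: eq_bigr => t /andP[t0 Et].
have -> : t = (t / u) * u by rewrite mulfVK.
rewrite push_dilate ?mul1r //; first apply: eq_push => z.
all: by rewrite ?finv ?mulf_neq0 ?invr_eq0 ?subfM ?subfV.
Qed.

Lemma card_subf : \sum_(u | subf u) (1 : int) = q%:R.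
Proof.
rewrite sum_subf card_subf_nonzero -[1]/(1%:R) -natrD; congr _%:R.
by rewrite /q; lia.
Qed.

Lemma sum_delta_subf (f : F -> int) x : subf x ->
  \sum_(u | subf u) (u == x)%:R * f u = f x.
Proof.
move=> Ex; rewrite (bigD1 x) //= eqxx mul1r big1 ?addr0 // => u /andP[_ /negbTE->].
by rewrite mul0r.
Qed.

Lemma sum_subf_shift (f : F -> int) s : subf s ->
  \sum_(u | subf u) f (u + s) = \sum_(u | subf u) f u.
Proof.
move=> Es; rewrite [RHS](reindex_inj (addIr s)) /=; apply: eq_bigl => u.
apply/idP/idP=> [Eu|]; first exact: subfD.
by move=> /subfD/(_ (subfN Es)); rewrite addrK.
Qed.

(** The autocorrelation is invariant under dilation by nonzero elements of E, is q - 1 at 0 and has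
    total 0, so it is -1 at each of the q - 1 nonzero points. *)
Lemma Dc_corr s : subf s ->
  \sum_(u | subf u) Dc 0 u * Dc 0 (u + s) = q%:R * (s == 0)%:R - 1.
Proof.
pose c s := \sum_(u | subf u) Dc 0 u * Dc 0 (u + s).
have qE : q%:R = (q - 1)%:R + 1 :> int by rewrite natr1; congr _%:R; rewrite /q; lia.
have c0 : c 0 = (q - 1)%:R.
  rewrite /c sum_subf Dc0 mul0r add0r -card_subf_nonzero.
  by apply: eq_bigr => u /andP[u0 Eu]; rewrite addr0 -expr2 Dc_subf_sqr.
have cZ t x : t != 0 -> subf t -> c (t * x) = c x.
  move=> t0 Et; rewrite /c (reindex_inj (mulfI t0)) /=.
  rewrite (eq_bigl _ _ (subf_dilate t0 Et)); apply: eq_bigr => u Eu.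
  rewrite -mulrDr !Dc_subf // mulrACA -expr2 Dc_subf_sqr //; exact: mul1r.
have csum : \sum_(x | subf x) c x = 0.
  rewrite exchange_big big1 //= => u Eu; rewrite -big_distrr /=.
  under eq_bigr => x _ do rewrite addrC.
  by rewrite sum_subf_shift // sum_Dc_subf mulr0.
move=> Es; rewrite -/(c s); have [->|s0] := eqVneq s 0.
  by rewrite c0 qE /=; ring.
rewrite /= mulr0 add0r; apply: (@mulfI _ ((q - 1)%:R : int)).
  by rewrite pnatr_eq0 -lt0n q_m1_gt0.
move: csum; rewrite sum_subf c0 => /eqP; rewrite addrC addr_eq0 mulrN1 => /eqP <-.
rewrite -card_subf_nonzero big_distrl /=; apply: eq_bigr => t /andP[t0 Et].
have {1}-> : t = (t / s) * s by rewrite mulfVK.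
by rewrite cZ ?mul1r ?mulf_neq0 ?invr_eq0 ?subfM ?subfV.
Qed.

(** The products of the delta with the character add up to x z ([Dc 0 s] + [Dc 0 (- s)]), which is 0
    as the character is odd. *)
Lemma shape_corr (h : F -> int) (x y z : int) s :
  (forall u, subf u -> h u = x * (u == 0)%:R + y + z * Dc 0 u) -> subf s ->
  \sum_(u | subf u) h u * h (u + s) =
  (x ^+ 2 + q%:R * z ^+ 2) * (s == 0)%:R + (2 * x * y + q%:R * y ^+ 2 - z ^+ 2).
Proof.
move=> hE Es; have ENs := subfN Es.
transitivity (\sum_(u | subf u) ((u == 0)%:R * (x * h (u + s)) +
    (u == - s)%:R * (x * (y + z * Dc 0 u)) + y ^+ 2 * 1 + y * z * Dc 0 (u + s) +
    y * z * Dc 0 u + z ^+ 2 * (Dc 0 u * Dc 0 (u + s)))).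
  apply: eq_bigr => u Eu; rewrite (hE u Eu) (hE _ (subfD Eu Es)).
  by rewrite -addr_eq0; ring.
rewrite !big_split /= !sum_delta_subf ?subf0 // -!big_distrr /= card_subf.
rewrite sum_subf_shift // sum_Dc_subf Dc_corr // add0r hE // Dc_N; ring.
Qed.

(* Each nonzero d lies in tau^-1(0) v for q - 1 nonzero v. *)
Lemma sum_push_tau f z0 :
  \sum_(v | v != 0) push v f (tau (z0 / v)) =
  n%:R * f z0 + (q - 1)%:R * (\sum_z f z - f z0).
Proof.
have cnt (d : F) : d != 0 ->
    \sum_(v : F | v != 0) ((subf (d / v))%:R : int) = (q - 1)%:R.
  move=> d0; rewrite -card_subf_nonzero.
  have inj : injective (fun v : F => d / v) by move=> u v /(mulfI d0)/invr_inj.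
  rewrite (reindex_inj inj) /= [RHS]big_mkcondr /=.
  apply: eq_big => v; first by rewrite mulf_eq0 (negbTE d0) invr_eq0.
  by move=> _; rewrite invf_div mulrCA mulfV // mulr1; case: (subf v).
rewrite /push; under eq_bigr => v _ do rewrite big_mkcond /=.
rewrite exchange_big /= (bigD1 z0) //= [\sum_z f z](bigD1 z0) //=.
congr (_ + _).
  rewrite (eq_bigr (fun v => 1 * f z0)) => [|v _]; last by rewrite eqxx mul1r.
  rewrite -big_distrl /= sum_nonzero sumr_const card_ord //.
rewrite [f z0 + _]addrC addrK big_distrr /=; apply: eq_bigr => z zz0.
rewrite -(cnt (z - z0)) ?subr_eq0 // big_distrl /=; apply: eq_bigr => v _.
by rewrite -subr_eq0 -tauB -mulrBl tau_eq0; case: ifP; rewrite ?mul1r ?mul0r.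
Qed.

Lemma push_sum v (f : nat -> F -> int) m u :
  push v (fun z => \sum_(k < m) f k z) u = \sum_(k < m) push v (f k) u.
Proof. by rewrite /push exchange_big. Qed.

Lemma push_delta v u : subf u -> v != 0 ->
  push v (fun z => (z == 0)%:R) u = (u == 0)%:R.
Proof.
move=> Eu v0; rewrite /push big_mkcond (bigD1 0) //= eqxx mul0r big1; last first.
  by move=> z /negbTE->; case: ifP.
by rewrite addr0 eq_sym (eqP (_ : tau 0 == 0)) ?tau_eq0 ?subf0 //; case: ifP.
Qed.

Lemma q_natE : q%:R = (q - 1)%:R + 1 :> int.
Proof. by rewrite natr1; congr _%:R; rewrite /q; lia. Qed.

Lemma n_natE : n%:R = (q%:R - 1) * (q%:R + 1) :> int.
Proof. by rewrite /n natrM natrD q_natE addrK. Qed.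

Lemma push_cst v u : subf u -> v != 0 -> push v (fun=> 1) u = q%:R.
Proof.
move=> Eu v0.
rewrite (_ : push _ _ _ = push v (fun z => (z != 0)%:R) u + push v (fun z => (z == 0)%:R) u).
  rewrite push_delta // (@push_invariant v _ (q%:R + 1)) ?v0 ?eqxx //=; first ring.
    by move=> t z t0 _; rewrite mulf_eq0 (negbTE t0).
  rewrite (bigD1 0) //= eqxx add0r (eq_bigr (fun=> 1)) => [|z ->] //.
  rewrite sum_nonzero sumr_const card_ord n_natE q_natE; ring.
by rewrite /push -big_split /=; apply: eq_bigr => z _; case: eqP.
Qed.

(* Radon inversion: a function on F whose pushforwards all vanish is zero. *)
Lemma push_inj (h : F -> int) :
  (forall v u, v != 0 -> subf u -> push v h u = 0) -> forall z, h z = 0.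
Proof.
move=> h0 z; have := sum_push_tau h z.
rewrite big1 => [|v v0]; last by rewrite h0 ?tau_subf.
rewrite -(sum_push 1) big1 => [|u Eu]; last by rewrite h0 ?oner_eq0.
rewrite sub0r mulrN -mulrBl.
have -> : n%:R - (q - 1)%:R = (q - 1)%:R * q%:R :> int by rewrite n_natE q_natE; ring.
move=> /esym/eqP; rewrite !mulf_eq0 !pnatr_eq0.
by rewrite !gtn_eqF ?q_gt0 ?q_m1_gt0 // => /eqP.
Qed.

(** Radon inversion applied to the difference of both sides. The constant c0 pushes forward to c0 q
    because every fibre has q elements. *)
Lemma corr_of_push (f : nat -> F -> int) (c1 c0 : int) :
  (forall v s, v != 0 -> subf s ->
     \sum_(k < 4) push v (xcorr (f k) (f k)) s = c1 * (s == 0)%:R + c0 * q%:R) ->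
  forall x, \sum_(k < 4) xcorr (f k) (f k) x = c1 * (x == 0)%:R + c0.
Proof.
move=> fP x; apply/eqP; rewrite -subr_eq0; apply/eqP.
pose h z := \sum_(k < 4) xcorr (f k) (f k) z - (c1 * (z == 0)%:R + c0).
apply: (push_inj (h := h)) => v u v0 Eu.
transitivity (push v (fun z => \sum_(k < 4) xcorr (f k) (f k) z) u -
    (c1 * push v (fun z => (z == 0)%:R) u + c0 * push v (fun=> 1) u)).
  rewrite /push sumrB big_split /= !big_distrr /=; congr (_ - (_ + _)).
  by apply: eq_bigr => z _; rewrite mulr1.
rewrite (push_sum _ (fun k => xcorr (f k) (f k))) fP //.
by rewrite push_delta // push_cst // subrr.
Qed.

(* As v runs through the powers of g, the multiple of [Dc 0] to which [Dc j]
   pushes forward depends only on the exponent of v minus j. *)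
Definition psi (l : nat) : int := push (g ^+ l) (Dc 0) 1.

Lemma Dc_shift j z : (j < 4)%N -> Dc j (z * g ^+ j) = Dc 0 z.
Proof.
move=> j4; have [->|z0] := eqVneq z 0; first by rewrite mul0r !Dc0.
have [l ->] := expgP z0; rewrite -exprD !Dc_exp /dn; do ![case: eqP]; lia.
Qed.

Lemma push_psi j l : (j < 4)%N -> push (g ^+ (l + j)) (Dc j) 1 = psi l.
Proof.
move=> j4; have gj0 := expf_neq0 j g_neq0.
rewrite /psi /push (reindex_inj (mulIf gj0)) /=; apply: eq_big => z.
  by rewrite exprD -mulf_div mulfV // mulr1.
by move=> _; exact: Dc_shift.
Qed.

Lemma push_add4 j l : (j < 4)%N ->
  push (g ^+ (l + 4)) (Dc j) 1 = - push (g ^+ l) (Dc j) 1.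
Proof.
move=> j4; have g40 := expf_neq0 4 g_neq0.
rewrite /push (reindex_inj (mulIf g40)) /= -sumrN; apply: eq_big => z.
  by rewrite exprD -mulf_div mulfV // mulr1.
move=> _; have [->|z0] := eqVneq z 0; first by rewrite mul0r Dc0 oppr0.
by have [i ->] := expgP z0; rewrite -exprD !Dc_exp dn4.
Qed.

Lemma psi_add4 l : psi (l + 4) = - psi l. Proof. exact: push_add4. Qed.

Lemma push_add4k j m i : (j < 4)%N ->
  push (g ^+ (i * 4 + m)) (Dc j) 1 = (-1) ^+ i * push (g ^+ m) (Dc j) 1.
Proof.
move=> j4; elim: i => [|i IH]; first by rewrite mul1r.
by rewrite mulSn -addnA addnC push_add4 // IH exprS mulN1r mulNr.
Qed.

(** The Frobenius multiplies exponents by q = 3 mod 8, which permutes the residues and fixes 0 and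
    4. *)
Lemma Dc_frob z : Dc 0 (z ^+ q) = Dc 0 z.
Proof.
have [->|z0] := eqVneq z 0; first by rewrite expr0n gtn_eqF ?q_gt0.
have [l ->] := expgP z0; rewrite -exprM !Dc_exp /dn.
have -> : (l * q %% 8 = (3 * (l %% 8)) %% 8)%N.
  by rewrite modnMmr /q mulnDr mulnCA [(8 * _)%N]mulnC modnMDl mulnC.
by have := ltn_pmod l (isT : 0 < 8)%N; case: (l %% 8)%N => [|[|[|[|[|[|[|[|]]]]]]]].
Qed.

(* [tau] anticommutes with the Frobenius z -> z^q, [Dc 0] is invariant under it. *)
Lemma psi_frob l : psi (l * q) = - psi l.
Proof.
have frob_inj : injective (fun z : F => z ^+ q) by apply: (can_inj (g := fun z => z ^+ q)) frobK.
rewrite /psi -[RHS]mulN1r -{1}Dc_N1 -push_Dc ?expf_neq0 ?g_neq0 ?subfN ?subf1 //.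
rewrite [RHS]/push (reindex_inj frob_inj) /= /push exprM.
apply: eq_big => z; last by rewrite Dc_frob.
rewrite -[g ^+ l]frobK -expr_div_n tau_frob frobK.
by rewrite (inj_eq oppr_inj).
Qed.

Lemma psi0 : psi 0 = 0.
Proof. by have := psi_frob 0; rewrite mul0n; lia. Qed.

(** The Frobenius relation gives psi q = - psi 1, and psi has period 8. *)
Lemma psi3 : psi 3 = - psi 1.
Proof.
rewrite -psi_frob mul1n /q; elim: b => // b' IH.
by rewrite IH mulnS (_ : 8 + 8 * b' + 3 = 8 * b' + 3 + 4 + 4)%N ?psi_add4 ?opprK //; lia.
Qed.

Lemma sum_Dc j : (j < 4)%N -> \sum_z Dc j z = 0.
Proof.
move=> j4; rewrite -(sum_push 1).
under eq_bigr => u Eu do rewrite push_Dc ?oner_eq0 //.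
by rewrite -big_distrl /= sum_Dc_subf mul0r.
Qed.

Lemma push_Dc_class m i : (m < 4)%N ->
  let s := (-1) ^+ i in let x := psi 2 in let y := psi 1 in
  let p j := push (g ^+ (i * 4 + m)) (Dc j) 1 in
  [/\ p 0 = s * [:: 0; y; x; - y]`_m, p 1 = s * [:: y; 0; y; x]`_m,
      p 2 = s * [:: - x; y; 0; y]`_m & p 3 = s * [:: - y; - x; y; 0]`_m].
Proof.
move=> m4 s x y p.
(* The added 4 keeps the subtraction from truncating, at the cost of a sign. *)
have pE j : (j < 4)%N -> p j = s * - psi (m + 4 - j).
  move=> j4; rewrite /p push_add4k //; congr (_ * _).
  apply: (canRL opprK); rewrite -push_add4 //.
  by rewrite -(push_psi _ j4) subnK // (leq_trans (ltnW j4)) // leq_addl.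
have psi4 : psi 4 = 0 by rewrite (psi_add4 0) psi0 oppr0.
have psi5 : psi 5 = - y by exact: (psi_add4 1).
have psi6 : psi 6 = - x by exact: (psi_add4 2).
have psi7 : psi 7 = y by rewrite (psi_add4 3) psi3 opprK.
rewrite !pE //.
by case: m m4 {p pE} => [|[|[|[|]]]] //= _; split;
  rewrite ?psi4 ?psi5 ?psi6 ?psi7 ?psi3 ?psi0 ?opprK ?oppr0.
Qed.

Lemma expg_class v : v != 0 -> exists i m, (m < 4)%N /\ v = g ^+ (i * 4 + m).
Proof.
move=> /expgP[l ->]; exists (l %/ 4)%N, (l %% 4)%N.
by rewrite ltn_pmod // -divn_eq.
Qed.

(* [sum_push_tau] at 0, for the sum of the autocorrelations of the D_j. *)
Lemma psi_norm : psi 2 ^+ 2 + 2 * psi 1 ^+ 2 = q%:R.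
Proof.
pose G z := \sum_(j < 4) xcorr (Dc j) (Dc j) z.
have G0 : G 0 = n%:R.
  rewrite /G exchange_big /= (bigD1 0) //= big1 => [|j _]; last by rewrite Dc0 mul0r.
  rewrite add0r -[n]card_ord -sumr_const -(sum_nonzero (fun=> 1)).
  apply: eq_bigr => z /expgP[l ->]; rewrite !big_ord_recr big_ord0 /= addr0 !Dc_exp /dn.
  have := ltn_pmod l (isT : 0 < 8)%N.
  by case: (l %% 8)%N => [|[|[|[|[|[|[|[|]]]]]]]].
have sumG : \sum_z G z = 0.
  rewrite exchange_big big1 //= => j _.
  by rewrite sum_xcorr sum_Dc ?mulr0.
have pushG v : v != 0 -> push v G 0 = (q - 1)%:R * (psi 2 ^+ 2 + 2 * psi 1 ^+ 2).
  move=> v0; rewrite (push_sum _ (fun j => xcorr (Dc j) (Dc j))).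
  transitivity (\sum_(j < 4) (q - 1)%:R * push v (Dc j) 1 ^+ 2).
    apply: eq_bigr => j _; rewrite push_xcorr.
    rewrite (@shape_corr _ 0 0 (push v (Dc j) 1)) ?subf0 //.
      by rewrite eqxx q_natE /=; ring.
    by move=> u Eu; rewrite push_Dc //; ring.
  rewrite -big_distrr; congr (_ * _); rewrite !big_ord_recr big_ord0 /=.
  have [i [m [m4 ->]]] := expg_class v0.
  have [-> -> -> ->] := push_Dc_class i m4.
  have := sqrr_sign int i; case: m m4 => [|[|[|[|]]]] //= _ s2; rewrite !exprMn s2; ring.
have := sum_push_tau G 0; rewrite G0 sumG.
rewrite (eq_bigr (fun v => 1 * push v G 0)) => [|v _]; last first.
  by rewrite mul0r mul1r (eqP (_ : tau 0 == 0)) ?tau_eq0 ?subf0.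
rewrite (eq_bigr (fun v => 1 * ((q - 1)%:R * (psi 2 ^+ 2 + 2 * psi 1 ^+ 2)))); last first.
  by move=> v v0; rewrite pushG.
rewrite -big_distrl /= sum_nonzero sumr_const card_ord sub0r => E.
have n0 : n%:R != 0 :> int by rewrite pnatr_eq0 -lt0n n_gt0.
have q10 : (q - 1)%:R != 0 :> int by rewrite pnatr_eq0 -lt0n q_m1_gt0.
apply: (mulfI q10); apply: (mulfI n0); rewrite E n_natE q_natE; ring.
Qed.

(** * The four pairs of functions *)

Definition comb (c : int * (seq int * seq int)) (z : F) : int :=
  c.1 * (z == 0)%:R + \sum_(j < 4) (c.2.1`_j * Uc j z + c.2.2`_j * Vc j z).

(* With d the indicator function of 0, the functions s are
     d + D_0,   A_0 + A_1 - A_2 - A_3,   V_1 + U_3,   A_0 + V_1 + V_3,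
   and the functions t are
     D_2 + A_1 - A_3,   d,   d - A_0 + A_2 + U_1 - V_3,   d + A_2 + U_1 - U_3. *)
Definition s_coef (k : nat) : int * (seq int * seq int) :=
  match k with
  | 0 => (1, ([:: 1; 0; 0; 0], [:: 1; 0; 0; 0]))
  | 1 => (0, ([:: 1; 1; -1; -1], [:: -1; -1; 1; 1]))
  | 2 => (0, ([:: 0; 0; 0; 1], [:: 0; 1; 0; 0]))
  | _ => (0, ([:: 1; 0; 0; 0], [:: -1; 1; 0; 1]))
  end.

Definition t_coef (k : nat) : int * (seq int * seq int) :=
  match k with
  | 0 => (0, ([:: 0; 1; 1; -1], [:: 0; -1; 1; 1]))
  | 1 => (1, ([:: 0; 0; 0; 0], [:: 0; 0; 0; 0]))
  | 2 => (1, ([:: -1; 1; 1; 0], [:: 1; 0; -1; -1]))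
  | _ => (1, ([:: 0; 1; 1; -1], [:: 0; 0; -1; 0]))
  end.

Lemma double_UcE j z : (j < 4)%N -> 2 * Uc j z = Ac j z + Dc j z.
Proof. by move=> j4; rewrite AcE // DcE; ring. Qed.

Lemma double_VcE j z : (j < 4)%N -> 2 * Vc j z = Dc j z - Ac j z.
Proof. by move=> j4; rewrite AcE // DcE; ring. Qed.

(** Doubling keeps the coefficients of A_j and D_j integral. *)
Lemma double_combE c z : 2 * comb c z = 2 * c.1 * (z == 0)%:R +
  \sum_(j < 4) ((c.2.1`_j - c.2.2`_j) * Ac j z + (c.2.1`_j + c.2.2`_j) * Dc j z).
Proof.
rewrite /comb mulrDr mulrA big_distrr /=; congr (_ + _); apply: eq_bigr => j _.
by rewrite mulrDr !(mulrCA 2) double_UcE // double_VcE //; ring.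
Qed.

Lemma push_Ac v j u : v != 0 -> (j < 4)%N -> subf u ->
  push v (Ac j) u = (q%:R * Ac j v - 1) * (u == 0)%:R + (1 - Ac j v).
Proof.
move=> v0 j4 Eu; apply: push_invariant => //.
- by move=> t z t0 Et; exact: Ac_subf.
- exact: Ac0.
- by rewrite sum_Ac // mulr1.
Qed.

Definition delta_part v (c : int * (seq int * seq int)) : int :=
  2 * c.1 + \sum_(j < 4) (c.2.1`_j - c.2.2`_j) * (q%:R * Ac j v - 1).
Definition const_part v (c : int * (seq int * seq int)) : int :=
  \sum_(j < 4) (c.2.1`_j - c.2.2`_j) * (1 - Ac j v).
Definition char_part v (c : int * (seq int * seq int)) : int :=
  \sum_(j < 4) (c.2.1`_j + c.2.2`_j) * push v (Dc j) 1.

Lemma push_comb v c u : v != 0 -> subf u ->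
  2 * push v (comb c) u =
  delta_part v c * (u == 0)%:R + const_part v c + char_part v c * Dc 0 u.
Proof.
move=> v0 Eu; rewrite {1}/push big_distrr /=.
under eq_bigr => z _ do rewrite double_combE.
rewrite big_split /= -big_distrr /= -/(push v _ u) push_delta //.
rewrite exchange_big /= /delta_part [(2 * _ + _) * _]mulrDl -!addrA; congr (_ + _).
rewrite /const_part /char_part. rewrite !big_distrl /= -!big_split /=; apply: eq_bigr => j _.
rewrite big_split /= -!big_distrr /= -/(push v _ u) push_Ac //.
by rewrite -/(push v _ u) push_Dc //; ring.
Qed.

(** By [shape_corr], the two hypotheses give the delta and constant coefficients of the
    pushed-forward correlations. The factor 4 comes from doubling both arguments. *)
Lemma corr_comb (cf : nat -> int * (seq int * seq int)) (c1 c0 : int) :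
  (forall v, v != 0 -> \sum_(k < 4)
     (delta_part v (cf k) ^+ 2 + q%:R * char_part v (cf k) ^+ 2) = 4 * c1) ->
  (forall v, v != 0 -> \sum_(k < 4)
     (2 * delta_part v (cf k) * const_part v (cf k) +
      q%:R * const_part v (cf k) ^+ 2 - char_part v (cf k) ^+ 2) = 4 * (c0 * q%:R)) ->
  forall x, \sum_(k < 4) xcorr (comb (cf k)) (comb (cf k)) x = c1 * (x == 0)%:R + c0.
Proof.
move=> H1 H0; apply: (@corr_of_push (fun k => comb (cf k))) => v s v0 Es.
apply: (@mulfI _ (4 : int)) => //.
rewrite mulrDr mulrA -(H1 v v0) -(H0 v v0) big_distrl /= -big_split /= big_distrr /=.
apply: eq_bigr => k _.
rewrite -(shape_corr (fun u Eu => push_comb (cf k) v0 Eu) Es) push_xcorr big_distrr /=.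
by apply: eq_bigr => u _; ring.
Qed.

Lemma Ac_class m i : (m < 4)%N -> exists2 e : int, e = 1 \/ e = -1 &
  forall j, Ac j (g ^+ (i * 4 + m)) = if m == j then e else 0.
Proof.
move=> m4; exists ((-1) ^+ (((i * 4 + m) %% (q + 1)) %/ 4)).
  by rewrite -signr_odd; case: (odd _); [right | left].
by move=> j; rewrite Ac_exp /an modnMDl modn_small.
Qed.

Lemma sign_or (i : nat) : (-1) ^+ i = 1 :> int \/ (-1) ^+ i = -1 :> int.
Proof. by rewrite -signr_odd; case: (odd _); [right | left]. Qed.

Lemma corr_s x :
  \sum_(k < 4) xcorr (comb (s_coef k)) (comb (s_coef k)) x =
  (2 * q%:R ^+ 2 + 1) * (x == 0)%:R - 2.
Proof.
apply: corr_comb => v /expg_class [i [m [m4 ->]]].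
all: have [e e1 AE] := Ac_class i m4; have [p0 p1 p2 p3] := push_Dc_class i m4.
all: rewrite /delta_part /const_part /char_part !big_ord_recr !big_ord0 /= !AE.
(* With q replaced by x^2 + 2 y^2, each class of v leaves polynomial identities in x and y. *)
all: rewrite p0 p1 p2 p3 -psi_norm.
all: case: m m4 {AE p0 p1 p2 p3} => [|[|[|[|]]]] //= _.
all: by case: e1 => ->; case: (sign_or i) => ->; ring.
Qed.

Lemma corr_t x :
  \sum_(k < 4) xcorr (comb (t_coef k)) (comb (t_coef k)) x =
  (2 * q%:R ^+ 2 + 1) * (x == 0)%:R.
Proof.
rewrite -[RHS]addr0; apply: corr_comb => v /expg_class [i [m [m4 ->]]].
all: have [e e1 AE] := Ac_class i m4; have [p0 p1 p2 p3] := push_Dc_class i m4.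
all: rewrite /delta_part /const_part /char_part !big_ord_recr !big_ord0 /= !AE.
all: rewrite p0 p1 p2 p3 -psi_norm.
all: case: m m4 {AE p0 p1 p2 p3} => [|[|[|[|]]]] //= _.
all: by case: e1 => ->; case: (sign_or i) => ->; ring.
Qed.

(** Every D_j has sum 0 and every A_j the same sum q - 1. In each s the coefficients of the A_j add
    up to 0, so only the origin contributes. *)
Lemma sum_comb_s k : (k < 4)%N -> \sum_z comb (s_coef k) z = (k == 0%N)%:R.
Proof.
move=> k4; apply: (@mulfI _ (2 : int)) => //; rewrite big_distrr /=.
under eq_bigr => z _ do rewrite double_combE.
rewrite big_split /= exchange_big /= -big_distrr /=.
have -> : \sum_(z : F) ((z == 0)%:R : int) = 1.
  by rewrite (bigD1 0) //= eqxx big1 ?addr0 // => z /negbTE->.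
rewrite (eq_bigr (fun j : 'I_4 => ((s_coef k).2.1`_j - (s_coef k).2.2`_j) * (q - 1)%:R)).
  rewrite !big_ord_recr big_ord0.
  by case: k k4 => [|[|[|[|]]]] //= _; rewrite ?q_natE; ring.
by move=> j _; rewrite big_split /= -!big_distrr /= sum_Ac // sum_Dc // mulr0 addr0.
Qed.

(** The supports of the eight functions U_j and V_j partition the nonzero elements. Complementarity
    of s and t thus becomes a check on the coefficient tables. *)
Lemma comb_class z : z != 0 -> exists m (e : int), [/\ (m < 4)%N, e = 1 \/ e = -1 &
  (forall c, comb c z = c.2.1`_m * e) \/ (forall c, comb c z = c.2.2`_m * e)].
Proof.
move=> z0; have [i [m [m4 Dz]]] := expg_class z0.
have DE j : (j < 4)%N -> j != m -> Dc j z = 0.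
  by move=> j4; rewrite Dz Dc_exp /dn; do ![case: eqP]; lia.
have Dm : Dc m z = 1 \/ Dc m z = -1.
  by rewrite Dz Dc_exp /dn; do ![case: eqP]; lia.
exists m, (Dc m z); split=> //.
have combE c : comb c z = c.2.1`_m * Uc m z + c.2.2`_m * Vc m z.
  rewrite /comb (negbTE z0) mulr0 add0r (bigD1 (Ordinal m4)) //= big1 ?addr0 //.
  move=> j; rewrite -val_eqE /= => jm.
  by rewrite /Uc /Vc DE // if_same !mulr0 addr0.
rewrite /Uc /Vc in combE; case: (Ac m z == Dc m z) in combE.
  by left=> c; rewrite combE mulr0 addr0.
by right=> c; rewrite combE mulr0 add0r.
Qed.

Lemma comb0 c : comb c 0 = c.1.
Proof.
rewrite /comb eqxx mulr1 big1 ?addr0 // => j _.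
by rewrite /Uc /Vc Dc0 if_same !mulr0 addr0.
Qed.

Lemma support_st k z : (k < 4)%N ->
  `|comb (s_coef k) z| + `|comb (t_coef k) z| = 1.
Proof.
move=> k4; have [->|z0] := eqVneq z 0.
  by rewrite !comb0; case: k k4 => [|[|[|[|]]]].
have [m [e [m4 e1 [cE|cE]]]] := comb_class z0; rewrite !cE;
  by case: k k4 => [|[|[|[|]]]] //= _; case: m m4 {cE} => [|[|[|[|]]]] //= _;
     case: e1 => ->.
Qed.

Theorem hadamard_of_primitive_root : hadamard_exists (4 * (2 * q ^ 2 + 1)).
Proof.
rewrite -cardF; apply: (@hadamard_of_disjoint_pairs _
  (fun k => comb (s_coef k)) (fun k => comb (t_coef k))).
- by move=> k z k4; exact: support_st.
- exact: sum_comb_s.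
- by move=> x; rewrite corr_s cardF natrD natrM natrX.
- by move=> x; rewrite corr_t cardF natrD natrM natrX.
Qed.

End CyclotomicPairs.

(** * Choice of the field, and reduction modulo 8 *)

Theorem hadamard_prime_power_3mod8 (q : nat) :
  prime_power q -> (q %% 8 = 3)%N -> hadamard_exists (4 * (2 * q ^ 2 + 1)).
Proof.
move=> [p [k [p_prime [k_gt0 Dq]]]] q8.
have k2_gt0 : (0 < k * 2)%N by rewrite muln_gt0 k_gt0.
have [F pF cardF] := pPrimePowerField p_prime k2_gt0.
have [g prim] := finField_primitive_root F.
have qE : q = (8 * (q %/ 8) + 3)%N by lia.
rewrite expnM -Dq qE in cardF.
rewrite qE; apply: hadamard_of_primitive_root cardF _ prim => x y.
(* q is a power of the characteristic p, so x -> x^q is additive. *)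
by apply: exprDn_pchar; rewrite -qE Dq pnatX pnatE // pF.
Qed.

Theorem theorem1p3 (q : nat) (c : int) :
  prime_power q ->
  (q%:Z = 12 * c ^+ 2 + 4 * c + 3) ->
  hadamard_exists (4 * (2 * q ^ 2 + 1))%N.
Proof.
move=> q_pp qc; apply: hadamard_prime_power_3mod8 => //.
(* Splitting by the parity of c turns q into 48 d^2 + 8 d + 3 or 48 d^2 + 56 d + 19, both 3 mod
   8. *)
have [d [cd|cd]] : exists d : int, c = 2 * d \/ c = 2 * d + 1.
  exists (c %/ 2)%Z; lia.
all: move: qc; rewrite cd; nia.
Qed.
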